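(* Let $q\in\mathbb F$ with $q\neq 0,\pm1$, and let $A$ be a vector space with two bilinear operations $\succ,\prec$. Let $(A,\vartriangleright,\vartriangleleft)$ be the $q$-algebra of $(A,\succ,\prec)$, i.e. $$x\vartriangleright y=x\succ y+q\,x\prec y,\qquad x\vartriangleleft y=x\prec y+q\,x\succ y,\qquad\forall x,y\in A.$$ Then the following are equivalent. (i) $(A,\succ,\prec)$ is a dendriform algebra satisfying, for all $x,y,z\in A$, $$x\succ(y\succ z)=(x\prec y)\prec z,\qquad (x\prec y)\succ z=x\prec(y\succ z),$$ $$(q^2+3q+2)(x\prec y)\prec z+(q^2+2q)\,x\succ(y\prec z)+(q^2-q)\,x\prec(y\prec z)=0.$$ (ii) $(A,\vartriangleright,\vartriangleleft)$ is an anti-dendriform algebra satisfying, for all $x,y,z\in A$, $$(x\vartriangleleft y)\vartriangleright z=x\vartriangleleft(y\vartriangleright z),$$ $$(-q^2+q+2)(x\vartriangleleft y)\vartriangleleft z-q^2(x\vartriangleright y)\vartriangleleft z+(q^2+q)\,x\vartriangleleft(y\vartriangleleft z)=0.$$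
   Context: All vector spaces are finite-dimensional over a field $\mathbb F$ of characteristic $0$. Dendriform algebra: a vector space $A$ with two bilinear operations $\succ,\prec$ such that, with $x\cdot y=x\succ y+x\prec y$, for all $x,y,z\in A$, $$x\succ(y\succ z)=(x\cdot y)\succ z,\qquad (x\prec y)\prec z=x\prec(y\cdot z),\qquad (x\succ y)\prec z=x\succ(y\prec z).$$ Anti-dendriform algebra: a vector space $A$ with two bilinear operations $\vartriangleright,\vartriangleleft$ such that, with $x\cdot y=x\vartriangleright y+x\vartriangleleft y$, for all $x,y,z\in A$, $$x\vartriangleright(y\vartriangleright z)=-(x\cdot y)\vartriangleright z=-x\vartriangleleft(y\cdot z)=(x\vartriangleleft y)\vartriangleleft z,\qquad (x\vartriangleright y)\vartriangleleft z=x\vartriangleright(y\vartriangleleft z).$$ *)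

(* Defs.v *)
From HB Require Import structures.
From mathcomp Require Import all_boot all_order all_algebra.

Set Implicit Arguments.
Unset Strict Implicit.
Unset Printing Implicit Defensive.

Import GRing.Theory.
Local Open Scope ring_scope.

Section Dendriform.
Variables (F : fieldType) (A : vectType F).

Record dendriform (succ prec : {bilinear A -> A -> A}) : Prop := Dendriform {
  dendriform_succ : forall x y z : A,
    succ x (succ y z) = succ (succ x y + prec x y) z;
  dendriform_prec : forall x y z : A,
    prec (prec x y) z = prec x (succ y z + prec y z);
  dendriform_mid : forall x y z : A,
    prec (succ x y) z = succ x (prec y z)
}.

Record anti_dendriform (rt lt : {bilinear A -> A -> A}) : Prop :=
  AntiDendriform {
  anti_dendriform_succ : forall x y z : A,
    rt x (rt y z) = - rt (rt x y + lt x y) z;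
  anti_dendriform_prec : forall x y z : A,
    - rt (rt x y + lt x y) z = - lt x (rt y z + lt y z);
  anti_dendriform_assoc : forall x y z : A,
    - lt x (rt y z + lt y z) = lt (lt x y) z;
  anti_dendriform_mid : forall x y z : A,
    lt (rt x y) z = rt x (lt y z)
}.

End Dendriform.

Section QAlgebra.
Variables (F : fieldType) (A : vectType F) (q : F).
Variables (succ prec : {bilinear A -> A -> A}).

Definition qright (x y : A) : A := succ x y + q *: prec x y.
Definition qleft (x y : A) : A := prec x y + q *: succ x y.

Fact qright_bilinear : bilinear_for *:%R *:%R qright.
Proof.
split=> [v a x y|u a x y]; rewrite /qright.
- by rewrite !linearPl /= !scalerDr !scalerA (mulrC q) addrACA.
- by rewrite !linearPr /= !scalerDr !scalerA (mulrC q) addrACA.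
Qed.

Fact qleft_bilinear : bilinear_for *:%R *:%R qleft.
Proof.
split=> [v a x y|u a x y]; rewrite /qleft.
- by rewrite !linearPl /= !scalerDr !scalerA (mulrC q) addrACA.
- by rewrite !linearPr /= !scalerDr !scalerA (mulrC q) addrACA.
Qed.

HB.instance Definition _ :=
  bilinear_isBilinear.Build F A A A *:%R *:%R qright qright_bilinear.
HB.instance Definition _ :=
  bilinear_isBilinear.Build F A A A *:%R *:%R qleft qleft_bilinear.

End QAlgebra.

(* Main.v *)
Require Import Defs.
From mathcomp Require Import all_boot all_order all_algebra.
From mathcomp Require Import ring.

Import GRing.Theory VectorInternalTheory.
Local Open Scope ring_scope.

(** Fix [x], [y], [z] and consider the eight cubic monomials: the four
    left-bracketed ones [(x * y) * z] and the four right-bracketed ones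
    [x * (y * z)], each [*] being one of the two operations.  Every axiom in
    (i) and in (ii) is a linear relation between them, and both systems have
    the same shape: four relations that express the right-bracketed monomials
    through the left-bracketed ones ([mirrored] below: mixed monomials
    reassociate, pure ones reassociate while swapping the operations), and two
    relations between left-bracketed monomials
    ([dendriform_mirrored], [anti_dendriform_mirrored]).

    Writing [a'] for the operation other than [a], the mirror relations all read
    [x a (y b z) = (x b' y) a' z].  The [q]-operation of [a] is [a + q a'], and
    that of [a'] is [a' + q a], so expanding both sides produces the same
    coefficients, and the relations pass to the [q]-algebra ([mirrored_qalg]).
    They pass back
    because the [(-q)]-algebra of the [q]-algebra is the original algebra with
    both operations multiplied by [1 - q ^+ 2], a nonzero scalar
    ([mirrored_of_qalg]).

    For the two remaining relations, let [D1 = 0], [D2 = 0] be those of (i) and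
    [E1 = 0], [E2 = 0] those of (ii).  Expanding the [q]-operations gives
      [E1 = D2 + (2 q + 1) D1]  and  [E2 = E1 - (1 - q ^+ 2) ^+ 2 D1]
    ([anti_sum_qalg], [anti_rel_qalg]), a change of generators that is
    invertible exactly because [q] is neither [1] nor [-1]. *)

Section CubicRelations.
Variables (F : fieldType) (A : vectType F).
Implicit Types (s p r l : {bilinear A -> A -> A}) (q : F).

Definition mirrored s p : Prop := forall x y z : A,
  [/\ s x (s y z) = p (p x y) z, p x (p y z) = s (s x y) z,
      s x (p y z) = p (s x y) z & p x (s y z) = s (p x y) z].

(** The relation [D1]: what the first two dendriform axioms amount to modulo
    the mirror relations. *)
Definition dend_sum s p (x y z : A) : A :=
  s (s x y) z + s (p x y) z - p (p x y) z.

(** The relation [D2]: the quadratic relation of (i), its right-bracketed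
    monomials having been replaced through the mirror relations. *)
Definition dend_rel q s p (x y z : A) : A :=
  (q ^+ 2 + 3%:R * q + 2%:R) *: p (p x y) z
  + (q ^+ 2 + 2%:R * q) *: p (s x y) z + (q ^+ 2 - q) *: s (s x y) z.

(** The relation [E1]: what the chain of anti-dendriform axioms amounts to
    modulo the mirror relations. *)
Definition anti_sum r l (x y z : A) : A :=
  l (l x y) z + (r (r x y) z + r (l x y) z).

(** The relation [E2]: the quadratic relation of (ii), rewritten through the
    mirror relations. *)
Definition anti_rel q r l (x y z : A) : A :=
  (- q ^+ 2 + q + 2%:R) *: l (l x y) z - q ^+ 2 *: l (r x y) z
  + (q ^+ 2 + q) *: r (r x y) z.

(** Splitting the product on the right of the second dendriform axiom leaves
    [p x (p y z)] equal to [p (p x y) z - s (p x y) z], and the first axiom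
    evaluates this difference to the pure monomial [s (s x y) z]. *)
Lemma dendriform_mirrored q s p :
  [/\ dendriform s p,
      forall x y z : A, s x (s y z) = p (p x y) z,
      forall x y z : A, s (p x y) z = p x (s y z) &
      forall x y z : A,
        (q ^+ 2 + 3%:R * q + 2%:R) *: p (p x y) z
        + (q ^+ 2 + 2%:R * q) *: s x (p y z)
        + (q ^+ 2 - q) *: p x (p y z) = 0]
  <-> [/\ mirrored s p, forall x y z, dend_sum s p x y z = 0 &
          forall x y z, dend_rel q s p x y z = 0].
Proof.
split=> [[[ax_s ax_p ax_m] ss ps rel] | [mir d1 d2]].
- have d1 x y z : p (p x y) z = s (s x y) z + s (p x y) z.
    by rewrite -ss ax_s linearDl.
  have mir : mirrored s p.
    move=> x y z; split; rewrite ?ss ?ax_m ?ps //.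
    have /eqP := ax_p x y z; rewrite linearDr /= -ps d1 addrC.
    by rewrite (inj_eq (addrI _)) => /eqP.
  split=> // x y z; first by rewrite /dend_sum d1 subrr.
  by have [_ pp sp _] := mir x y z; have := rel x y z; rewrite pp sp.
- have d1E x y z : p (p x y) z = s (s x y) z + s (p x y) z.
    by apply/esym/eqP; rewrite -subr_eq0; apply/eqP/d1.
  split; first split; move=> x y z; have [ss pp sp ps] := mir x y z.
  + by rewrite ss linearDl d1E.
  + by rewrite linearDr /= ps pp d1E addrC.
  + by rewrite sp.
  + by [].
  + by rewrite ps.
  + by rewrite sp pp; apply: d2.
Qed.

(** The outer equality of the chain of axioms is the mirror relation for
    [r x (r y z)], and the middle one, after cancelling the mixed terms, is the
    one for [l x (l y z)]. *)
Lemma anti_dendriform_mirrored q r l :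
  [/\ anti_dendriform r l,
      forall x y z : A, r (l x y) z = l x (r y z) &
      forall x y z : A,
        (- q ^+ 2 + q + 2%:R) *: l (l x y) z
        - q ^+ 2 *: l (r x y) z
        + (q ^+ 2 + q) *: l x (l y z) = 0]
  <-> [/\ mirrored r l, forall x y z, anti_sum r l x y z = 0 &
          forall x y z, anti_rel q r l x y z = 0].
Proof.
split=> [[[ax_r ax_l ax_a ax_m] lr rel] | [mir e1 e2]].
- have mir : mirrored r l.
    move=> x y z; split; rewrite ?ax_m ?lr //.
      by rewrite ax_r ax_l ax_a.
    have /oppr_inj/eqP := ax_l x y z; rewrite linearDl linearDr /= lr addrC.
    by rewrite (inj_eq (addrI _)) => /eqP.
  split=> // x y z; have [rr ll _ _] := mir x y z.
    by rewrite /anti_sum -rr ax_r linearDl addNr.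
  by have := rel x y z; rewrite ll.
- have e1E x y z : l (l x y) z = - (r (r x y) z + r (l x y) z).
    by apply/eqP; rewrite -addr_eq0; apply/eqP/e1.
  split; first split; move=> x y z; have [rr ll rl lr] := mir x y z.
  + by rewrite rr linearDl e1E.
  + by rewrite linearDl linearDr /= lr ll addrC.
  + by rewrite linearDr /= lr ll e1E addrC.
  + by rewrite rl.
  + by rewrite lr.
  + by rewrite ll; apply: e2.
Qed.

(* An identity between explicit linear combinations of vectors is checked on
   coordinates, where it becomes an identity in the field. *)
Ltac vector_ring :=
  apply: (can_inj (@v2rK _ _)); apply/rowP=> i;
  rewrite ?(linearD, linearB, linearN, linearZ) /= !mxE; ring.

Lemma bilinearDZl (f : {bilinear A -> A -> A}) q (u v w : A) :
  f (u + q *: v) w = f u w + q *: f v w.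
Proof. by rewrite linearDl linearZl_LR. Qed.

Lemma bilinearDZr (f : {bilinear A -> A -> A}) q (u v w : A) :
  f w (u + q *: v) = f w u + q *: f w v.
Proof. by rewrite linearDr linearZr_LR. Qed.

Definition qalgE := (bilinearDZl, bilinearDZr).

Lemma mirrored_qalg q s p :
  mirrored s p -> mirrored (qright q s p) (qleft q s p).
Proof.
move=> mir x y z; have [ss pp sp ps] := mir x y z.
split; rewrite /= /qright /qleft !qalgE ss pp sp ps; vector_ring.
Qed.

Lemma qright_qalg q s p (x y : A) :
  qright (- q) (qright q s p) (qleft q s p) x y = (1 - q ^+ 2) *: s x y.
Proof. rewrite /qright /= /qright /qleft; vector_ring. Qed.

Lemma qleft_qalg q s p (x y : A) :
  qleft (- q) (qright q s p) (qleft q s p) x y = (1 - q ^+ 2) *: p x y.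
Proof. rewrite /qleft /= /qright /qleft; vector_ring. Qed.

Lemma mirrored_of_qalg q s p : 1 - q ^+ 2 != 0 ->
  mirrored (qright q s p) (qleft q s p) -> mirrored s p.
Proof.
move=> c_neq0 /(mirrored_qalg (- q)) mir x y z.
have [] := mir x y z.
(* Both sides of each relation now carry the factor [(1 - q ^+ 2) ^+ 2]. *)
rewrite /= !qright_qalg !qleft_qalg !linearZl_LR !linearZr_LR /=.
by do 4!move=> /(scalerI c_neq0)/(scalerI c_neq0) ?; split.
Qed.

Lemma anti_sum_qalg q s p (x y z : A) :
  anti_sum (qright q s p) (qleft q s p) x y z
  = dend_rel q s p x y z + (2%:R * q + 1) *: dend_sum s p x y z.
Proof.
rewrite /anti_sum /dend_rel /dend_sum /= /qright /qleft !qalgE; vector_ring.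
Qed.

Lemma anti_rel_qalg q s p (x y z : A) :
  anti_rel q (qright q s p) (qleft q s p) x y z
  = anti_sum (qright q s p) (qleft q s p) x y z
    - (1 - q ^+ 2) ^+ 2 *: dend_sum s p x y z.
Proof.
rewrite /anti_rel /anti_sum /dend_sum /= /qright /qleft !qalgE; vector_ring.
Qed.

End CubicRelations.

Theorem theorem3p6 (F : fieldType) (charF0 : [pchar F] =i pred0)
    (A : vectType F) (q : F) (q_neq0 : q <> 0) (q_neq1 : q <> 1)
    (q_neqN1 : q <> -1) (succ prec : {bilinear A -> A -> A}) :
  let rt : {bilinear A -> A -> A} := qright q succ prec in
  let lt : {bilinear A -> A -> A} := qleft q succ prec in
  [/\ dendriform succ prec,
      forall x y z : A, succ x (succ y z) = prec (prec x y) z,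
      forall x y z : A, succ (prec x y) z = prec x (succ y z) &
      forall x y z : A,
        (q ^+ 2 + 3%:R * q + 2%:R) *: prec (prec x y) z
        + (q ^+ 2 + 2%:R * q) *: succ x (prec y z)
        + (q ^+ 2 - q) *: prec x (prec y z) = 0]
  <->
  [/\ anti_dendriform rt lt,
      forall x y z : A, rt (lt x y) z = lt x (rt y z) &
      forall x y z : A,
        (- q ^+ 2 + q + 2%:R) *: lt (lt x y) z
        - q ^+ 2 *: lt (rt x y) z
        + (q ^+ 2 + q) *: lt x (lt y z) = 0].
Proof.
have c_neq0 : 1 - q ^+ 2 != 0.
  rewrite subr_eq0 eq_sym sqrf_eq1 negb_or.
  by apply/andP; split; apply/eqP.
move=> rt lt; rewrite dendriform_mirrored anti_dendriform_mirrored.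
split=> [[mir d1 d2] | [mir e1 e2]].
- have e1 x y z : anti_sum _ _ rt lt x y z = 0.
    by rewrite anti_sum_qalg d1 d2 scaler0 addr0.
  split=> [|//|x y z]; first exact: mirrored_qalg.
  by rewrite anti_rel_qalg e1 d1 scaler0 subr0.
- have d1 x y z : dend_sum _ _ succ prec x y z = 0.
    have /eqP := e2 x y z; rewrite anti_rel_qalg e1 sub0r oppr_eq0.
    by rewrite scaler_eq0 expf_eq0 (negPf c_neq0) => /eqP.
  split=> [|//|x y z]; first exact: mirrored_of_qalg c_neq0 mir.
  by have := e1 x y z; rewrite anti_sum_qalg d1 scaler0 addr0.
Qed.
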